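(* Fix $r>1$. Let $\lambda\in(0,1]$ and let $\rho:[0,1]\to[\lambda,1/\lambda]$ be a periodic probability density of class $C^{2,\alpha}$ for some $\alpha\in(0,1)$. Let $f(0,\cdot):[0,1]\to\mathbb{R}$ be a probability density satisfying $0<a_1\le f(0,\cdot)\le A_1$, where $a_1,A_1$ are constants, and let $f$ be a solution, with periodic boundary conditions and initial datum $f(0,\cdot)$, of $$\partial_t f(t,x)=-r\,\partial_x\Big(f(t,x)\,\partial_x\Big(\frac{\rho(x)}{f(t,x)^{r+1}}\Big)\Big)\qquad\text{in }(0,\infty)\times[0,1].$$ Then $$a:=a_1\lambda^{2/(r+1)}\le f(t,x)\le \frac{A_1}{\lambda^{2/(r+1)}}=:A\qquad\text{for all }t\ge 0,\ x\in[0,1],$$ and there exist positive constants $C_0,c_0$, depending only on $\lambda$, $a_1$ and $A_1$ (and on the fixed exponent $r$), such that $$\big\|f(t,\cdot)-\gamma\,\rho^{1/(r+1)}\big\|_{L^2([0,1])}\le C_0\,e^{-c_0t}\qquad\text{for all }t\ge 0,$$ where $\gamma:=\Big(\int_0^1\rho(y)^{1/(r+1)}\,dy\Big)^{-1}$.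
   Context: Periodic functions on $[0,1]$ are identified with $1$-periodic functions on $\mathbb{R}$ (equivalently, functions on the circle $\mathbb{R}/\mathbb{Z}$), and $C^{2,\alpha}$ regularity of a periodic function refers to its periodic extension. A probability density is a nonnegative function with $\int_0^1\cdot\,dx=1$. Solutions are positive classical solutions: $f>0$, $f(t,\cdot)$ is $1$-periodic in $x$, $f(t,\cdot)$ is of class $C^{2,\alpha}$ for $t>0$, $f$ is $C^1$ in $t$ and $C^2$ in $x$ (with jointly continuous derivatives) on $(0,\infty)\times\mathbb{R}$, the equation holds pointwise there, and $f(t,\cdot)\to f(0,\cdot)$ in $L^1([0,1])$ as $t\to0^+$. With periodic boundary conditions the mass is preserved, so $f(t,\cdot)$ is a probability density for all $t\ge0$. *)

(* Defs.v *)
From HB Require Import structures.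
From mathcomp Require Import all_boot all_order all_algebra.
From mathcomp Require Import all_classical all_reals all_analysis.
Import Order.TTheory GRing.Theory Num.Theory.
Import numFieldNormedType.Exports.

Set Implicit Arguments.
Unset Strict Implicit.
Unset Printing Implicit Defensive.

Local Open Scope ring_scope.
Local Open Scope classical_set_scope.

(* Functions on the circle are represented by functions g : R -> R such that
   periodic g 1; integrals and norms only involve their restriction to [0,1]. *)

(* The real line with the Lebesgue (not merely Borel) measurable sets: this is
   the domain of completed_lebesgue_measure.  The initial datum below is only
   required to be Lebesgue measurable. *)
Definition lebesgueType (R : realType) : measurableType _ :=
  caratheodory_type (@wlength R idfun)^*%mu.

Definition unit_itv (R : realType) : set (lebesgueType R) :=
  [set x : R | 0 <= x <= 1].

Definition integral01 (R : realType) (g : R -> R) : \bar R :=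
  (\int[@completed_lebesgue_measure R]_(x in @unit_itv R) (g x)%:E)%E.

Definition Lnorm01 (R : realType) (p : \bar R) (g : R -> R) : \bar R :=
  ('N[@completed_lebesgue_measure R]_p [EFin \o (g \_ (@unit_itv R))])%E.

Definition prob_density (R : realType) (g : R -> R) : Prop :=
  [/\ measurable_fun (@unit_itv R) (g : lebesgueType R -> R),
      forall x : R, 0 <= x <= 1 -> 0 <= g x
    & integral01 g = 1%E].

Definition holder (R : realType) (alpha : R) (g : R -> R) : Prop :=
  exists K : R, forall x y : R, `|g x - g y| <= K * `|x - y| `^ alpha.

(* Continuity of g and its first two derivatives follows from the conditions
   below when 0 < alpha. For periodic g, a uniform Hoelder bound on R is the
   same as one on the circle. *)
Definition C2_holder (R : realType) (alpha : R) (g : R -> R) : Prop :=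
  [/\ forall x : R, derivable g x 1,
      forall x : R, derivable (derive1 g) x 1
    & holder alpha (derive1n 2 g)].

(* Joint continuity on the open set (0, +oo) x R. *)
Definition continuous_pos (R : realType) (g : R -> R -> R) : Prop :=
  forall t x : R, 0 < t ->
    {for (t, x), continuous (fun p : R * R => g p.1 p.2)}.

(* f t x is the value at time t and position x; values at negative times are
   irrelevant. *)
Record solution (R : realType) (r alpha : R) (rho : R -> R) (f : R -> R -> R)
    : Prop := {
  sol_gt0 : forall t x : R, 0 <= t -> 0 < f t x;
  sol_periodic : forall t : R, 0 <= t -> periodic (f t) 1;
  sol_C2_holder : forall t : R, 0 < t -> C2_holder alpha (f t);
  sol_derivable_t : forall t x : R, 0 < t -> derivable (f^~ x) t 1;
  sol_continuous : continuous_pos f;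
  sol_continuous_dt : continuous_pos (fun t x => derive1 (f^~ x) t);
  sol_continuous_dx : continuous_pos (fun t x => derive1 (f t) x);
  sol_continuous_dxx : continuous_pos (fun t x => derive1n 2 (f t) x);
  sol_eq : forall t x : R, 0 < t ->
    derive1 (f^~ x) t =
      - r * derive1 (fun y =>
              f t y * derive1 (fun z => rho z / f t z `^ (r + 1)) y) x;
  sol_init : Lnorm01 1 (fun x => f t x - f 0 x) @[t --> 0^'+] --> 0%E
}.

(* The normalising constant of the equilibrium gamma * rho ^ (1 / (r + 1)). *)
Definition gamma_cst (R : realType) (r : R) (rho : R -> R) : R :=
  (fine (integral01 (fun y => rho y `^ (r + 1)^-1)))^-1.

(* Main.v *)
Require Import Defs.
From HB Require Import structures.
From mathcomp Require Import all_boot all_order all_algebra.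
From mathcomp Require Import all_classical all_reals all_analysis.
From mathcomp Require Import measurable_realfun.
From mathcomp Require Import ring lra.
Import Order.TTheory GRing.Theory Num.Theory.
Import numFieldNormedType.Exports.

(** Write m = rho ^ (1 / (r + 1)) for the shape of the equilibrium and u = f / m
    for the density relative to it.  Since rho / f ^ (r + 1) = u ^ - (r + 1), the
    equation is a nonlinear diffusion for u,
      m * u_t = r (r + 1) * (a * u_x)_x,   a = f * u ^ (- (r + 1) - 1) > 0,
    so that, for phi of class C^2 on (0, +oo), an integration by parts on the
    circle gives the dissipation identity [is_derive_entropy]
      d/dt int m phi(u) = - r (r + 1) * int phi''(u) * a * u_x ^ 2   (t > 0).
    Three kinds of phi yield everything.

    - Let [lo, hi] contain the values of u at time 0, and take phi convex,
      vanishing on [lo, hi] and dominated by the distance to [lo, hi].  Then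
      int m phi(u) is nonincreasing on (0, +oo) and tends to 0 as t -> 0+,
      because f(t) -> f(0) in L^1; it therefore vanishes
      ([entropy_vanishes]).  One phi positive below lo and one positive above
      hi confine u to [lo, hi] ([relative_density_bounds]).  The L^1 convergence
      is the only information available at time 0, hence the condition that
      phi grow at most linearly.

    - phi = id and phi = - id give the conservation of mass, int f(t) = 1
      ([mass_conserved]).

    - phi(v) = (v - gamma) ^ 2 gives the decay.  By conservation of mass,
      u - gamma has zero mean for the weight m, so the one-dimensional Poincare
      inequality [sqr_le_energy] bounds it pointwise by int u_x ^ 2; the bounds
      on u bound the mobility a from below, whence E' <= - c E for the quadratic
      entropy E, with c depending only on r, lambda and A1.  Gronwall's
      argument ([exponential_decay]) and the comparison of E with the square of
      the L^2 norm of f - gamma m conclude. *)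

Set Implicit Arguments.
Unset Strict Implicit.
Unset Printing Implicit Defensive.

Local Open Scope ring_scope.
Local Open Scope classical_set_scope.

(** * Borel functions and the completed Lebesgue measure *)

Section unit_interval_integrals.
Context {R : realType}.
Notation mu := (@lebesgue_measure R).
Notation cmu := (@completed_lebesgue_measure R).
Implicit Types (g h : R -> R).

Lemma measurable_borel_lebesgue (A : set R) :
  measurable A -> measurable (A : set (lebesgueType R)).
Proof.
move=> mA.
have := @sub_caratheodory _ _ _ (@wlength R idfun).
exact.
Qed.

Lemma measurable_id_lebesgue :
  measurable_fun [set: lebesgueType R] (idfun : lebesgueType R -> measurableTypeR R).
Proof.
move=> _ A mA; rewrite setTI; exact: measurable_borel_lebesgue.
Qed.

Lemma unit_itvE : @unit_itv R = `[0%R, 1%R]%classic :> set R.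
Proof. by apply/seteqP; split=> x; rewrite /unit_itv/= in_itv. Qed.

Lemma measurable_unit_itv : measurable (@unit_itv R).
Proof. by rewrite unit_itvE; exact: measurable_borel_lebesgue. Qed.

(** The Lebesgue measure on Borel sets is the push-forward of the completed
    measure by the identity.  This lets every integral of a Borel function be
    computed with the uncompleted measure, for which the fundamental theorem of
    calculus is available. *)
Lemma ge0_integral_completed (g : R -> \bar R) :
  measurable_fun (`[0%R, 1%R]%classic : set (measurableTypeR R)) g ->
  (forall x, 0 <= x <= 1 -> (0 <= g x)%E) ->
  (\int[cmu]_(x in @unit_itv R) g x = \int[mu]_(x in `[0%R, 1%R]) g x)%E.
Proof.
move=> mg g0.
rewrite unit_itvE.
have := ge0_integral_pushforward measurable_id_lebesgue cmu _ mg.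
set X := integral (pushforward _ _) _ _.
set Y := (Z in _ -> _ = Z).
have -> : Y = X .
  by [].
move=> -> //.
by move=> x; rewrite inE/= in_itv/= => /g0.
Qed.
End unit_interval_integrals.

(** * Integration of continuous functions over the unit interval *)

Definition int01 (R : realType) (g : R -> R) : R :=
  \int[@lebesgue_measure R]_(x in `[0%R, 1%R]) g x.

Section int01_theory.
Context {R : realType}.
Notation mu := (@lebesgue_measure R).
Notation cmu := (@completed_lebesgue_measure R).
Implicit Types (g h F : R -> R).

Lemma integrable01 g : continuous g ->
  mu.-integrable `[0%R, 1%R]%classic (EFin \o g).
Proof.
move=> cg; apply: continuous_compact_integrable; first exact: segment_compact.
exact: continuous_subspaceT.
Qed.

Lemma int01E g : continuous g ->
  (int01 g)%:E = (\int[mu]_(x in `[0%R, 1%R]) (g x)%:E)%E.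
Proof.
move=> cg; rewrite /int01 /Rintegral fineK//.
exact/integrable_fin_num/integrable01.
Qed.

Lemma int01_integral_completed g : continuous g ->
  (forall x, 0 <= x <= 1 -> 0 <= g x) ->
  (\int[cmu]_(x in @unit_itv R) (g x)%:E = (int01 g)%:E)%E.
Proof.
move=> cg g0; rewrite int01E//; apply: ge0_integral_completed => //.
by apply/measurable_EFinP; apply/measurable_funTS; exact: continuous_measurable_fun.
Qed.

Lemma le_int01 g h : continuous g -> continuous h ->
  (forall x, 0 <= x <= 1 -> g x <= h x) -> int01 g <= int01 h.
Proof.
move=> cg ch gh; by apply: le_Rintegral => //; exact: integrable01.
Qed.

Lemma int01_ge0 g : (forall x, 0 <= x <= 1 -> 0 <= g x) -> 0 <= int01 g.
Proof.
by move=> g0; apply: Rintegral_ge0 => x; rewrite /= in_itv; exact: g0.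
Qed.

Lemma int01_cst (c : R) : int01 (fun=> c) = c.
Proof.
by rewrite /int01 Rintegral_cst//= lebesgue_measure_itv/= lte_fin ltr01 oppr0
  adde0 mulr1.
Qed.

Lemma int01D g h : continuous g -> continuous h ->
  int01 (fun x => g x + h x) = int01 g + int01 h.
Proof. by move=> cg ch; rewrite /int01 RintegralD//; exact: integrable01. Qed.

Lemma int01Z (c : R) g : continuous g -> int01 (fun x => c * g x) = c * int01 g.
Proof. by move=> cg; rewrite /int01 RintegralZl//; exact: integrable01. Qed.

Lemma int01B g h : continuous g -> continuous h ->
  int01 (fun x => g x - h x) = int01 g - int01 h.
Proof. by move=> cg ch; rewrite /int01 RintegralB//; exact: integrable01. Qed.

Lemma eq_int01 g h : (forall x, 0 <= x <= 1 -> g x = h x) -> int01 g = int01 h.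
Proof.
by move=> gh; apply: eq_Rintegral => x; rewrite inE/= in_itv => /gh.
Qed.

Lemma int01_derive g F : continuous g -> (forall x : R, is_derive x 1 F (g x)) ->
  int01 g = F 1 - F 0.
Proof.
move=> cg dF; rewrite /int01 /Rintegral (@continuous_FTC2 _ g F 0 1)//.
- exact: continuous_subspaceT.
- have cF x : F y @[y --> x] --> F x.
    by apply/differentiable_continuous/derivable1_diffP; exact: ex_derive.
  split.
  + by move=> x _; exact: ex_derive.
  + exact/cvg_at_right_filter/cF.
  + exact/cvg_at_left_filter/cF.
- by move=> x _; rewrite derive1E; exact: derive_val.
Qed.

Lemma int01_ge_subitv g (c d e : R) : continuous g ->
  (forall x, 0 <= x <= 1 -> 0 <= g x) -> 0 <= c -> c <= d -> d <= 1 ->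
  (forall x, c <= x <= d -> e <= g x) -> e * (d - c) <= int01 g.
Proof.
move=> cg g0 c0 cd d1 eg.
have mE A : measurable_fun (A : set (measurableTypeR R)) (EFin \o g).
  by apply/measurable_EFinP; apply/measurable_funTS; exact: continuous_measurable_fun.
have cd01 : `[c, d]%classic `<=` `[0%R, 1%R]%classic.
  by apply: subset_itv; rewrite bnd_simp.
have icd : mu.-integrable `[c, d]%classic (EFin \o g).
  by apply: integrableS (integrable01 _).
rewrite -lee_fin int01E//.
apply: (@le_trans _ _ (\int[mu]_(x in `[c, d]) (g x)%:E)%E); last first.
  exact: ge0_subset_integral.
apply: (@le_trans _ _ (\int[mu]_(x in `[c, d]) cst e%:E x)%E).
  rewrite integral_cst//= lebesgue_measure_itv/= lte_fin.
  case: ltP => [_|dc]; first by rewrite -EFinD -EFinM.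
  have -> : d = c by apply/eqP; rewrite eq_le dc cd.
  by rewrite subrr mulr0 mule0.
apply: le_integral => //.
- apply: continuous_compact_integrable; first exact: segment_compact.
  by apply: continuous_subspaceT => ?; exact: cvg_cst.
- by move=> x; rewrite inE/= in_itv/= => xcd; rewrite lee_fin; exact: eg.
Qed.

(** A positive value at x propagates to an interval of positive length inside
    the unit interval, to the right or to the left of x according to the half
    in which x lies. *)
Lemma int01_eq0 g : continuous g -> (forall x, 0 <= x <= 1 -> 0 <= g x) ->
  int01 g = 0 -> forall x, 0 <= x <= 1 -> g x = 0.
Proof.
move=> cg g0 g_eq0 x x01; apply/eqP; rewrite eq_le g0// andbT leNgt.
apply/negP => gx0.
have gx2 : 0 < g x / 2 by rewrite divr_gt0.
have /cvgrPdist_lt/(_ _ gx2)[e /= e0 xe] := cg x.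
pose d := Num.min (e / 2) (1 / 2).
have d0 : 0 < d by rewrite lt_min !divr_gt0.
have dle : d <= e / 2 /\ d <= 1 / 2.
  by split; rewrite /d ge_min lexx ?orbT.
have near_x y : x - d <= y <= x + d -> g x / 2 <= g y.
  move=> xyd; have : `|x - y| < e.
    by rewrite ltr_norml; apply/andP; split; lra.
  move/xe; rewrite ltr_norml => /andP[_]; lra.
have [x2|x2] := leP x (1 / 2).
- have := @int01_ge_subitv g x (x + d) (g x / 2) cg g0.
  have H : forall y, x <= y <= x + d -> g x / 2 <= g y.
    by move=> y xy; apply: near_x; lra.
  move=> /(_ _ _ _ H); rewrite g_eq0.
  suff : 0 < g x / 2 * (x + d - x) by move=> ? /(_ _ _ _); lra.
  by rewrite mulr_gt0//; lra.
- have := @int01_ge_subitv g (x - d) x (g x / 2) cg g0.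
  have H : forall y, x - d <= y <= x -> g x / 2 <= g y.
    by move=> y xy; apply: near_x; lra.
  move=> /(_ _ _ _ H); rewrite g_eq0.
  suff : 0 < g x / 2 * (x - (x - d)) by move=> ? /(_ _ _ _); lra.
  by rewrite mulr_gt0//; lra.
Qed.

Lemma measurable_lebesgue g : continuous g ->
  measurable_fun (@unit_itv R) (g : lebesgueType R -> R).
Proof.
move=> cg; apply: measurable_funTS.
exact: (measurableT_comp (continuous_measurable_fun cg) (@measurable_id_lebesgue R)).
Qed.

Lemma Lnorm01_1 (g : R -> R) :
  Lnorm01 1 g = (\int[cmu]_(x in @unit_itv R) `|g x|%:E)%E.
Proof.
rewrite /Lnorm01 Lnorm1 [RHS]integral_mkcond; apply: eq_integral => x _.
by rewrite /patch/= /patch; case: ifP => _ //=; rewrite normr0.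
Qed.

Lemma Lnorm01_2 (g : R -> R) :
  Lnorm01 2%:E g = ((\int[cmu]_(x in @unit_itv R) (g x ^+ 2)%:E) `^ 2^-1)%E.
Proof.
rewrite /Lnorm01 Lnorm.unlock [in RHS]integral_mkcond; congr (_ `^ _)%E.
apply: eq_integral => x _; rewrite /patch/= /patch.
case: ifP => _.
  by rewrite powR_mulrn// real_normK// num_real.
(* outside the unit interval both restrictions take the default value 0 *)
change ((`|0 : R| `^ 2)%:E = 0%:E); by rewrite normr0 powR0.
Qed.

Lemma Lnorm01_2_le (g : R -> R) (b : R) : 0 <= b ->
  (\int[cmu]_(x in @unit_itv R) (g x ^+ 2)%:E <= (b ^+ 2)%:E)%E ->
  (Lnorm01 2%:E g <= b%:E)%E.
Proof.
move=> b0 h; rewrite Lnorm01_2.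
have i0 : (0 <= \int[cmu]_(x in @unit_itv R) (g x ^+ 2)%:E)%E.
  by apply: integral_ge0 => x _; rewrite lee_fin sqr_ge0.
have -> : b%:E = ((b ^+ 2)%:E `^ 2^-1)%E.
  by rewrite poweR_EFin powR12_sqrt ?sqr_ge0// sqrtr_sqr ger0_norm.
by apply: gt0_ler_poweR => //; rewrite in_itv/= leey ?andbT// lee_fin sqr_ge0.
Qed.

(** The function h stands for the difference with the initial datum, which is
    only Lebesgue measurable. *)
Lemma int01_le_Lnorm1 (g h : R -> R) (L : R) : continuous g ->
  measurable_fun (@unit_itv R) (h : lebesgueType R -> R) -> 0 <= L ->
  (forall x, 0 <= x <= 1 -> 0 <= g x) ->
  (forall x, 0 <= x <= 1 -> g x <= L * `|h x|) ->
  ((int01 g)%:E <= L%:E * Lnorm01 1 h)%E.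
Proof.
move=> cg mh L0 g0 gh; rewrite Lnorm01_1 -int01_integral_completed//.
have mnh : measurable_fun (@unit_itv R) (fun x : lebesgueType R => `|h x|%:E).
  by apply/measurable_EFinP; exact: measurableT_comp.
rewrite -ge0_integralZl//; last exact: measurable_unit_itv.
apply: ge0_le_integral.
- exact: measurable_unit_itv.
- by move=> x x01; rewrite lee_fin g0.
- by apply/measurable_EFinP; exact: measurable_lebesgue.
- by apply: measurable_funeM.
- by move=> x x01; rewrite -EFinM lee_fin gh.
Qed.

Lemma Lnorm1_triangle (g h : R -> R) :
  measurable_fun (@unit_itv R) (g : lebesgueType R -> R) ->
  measurable_fun (@unit_itv R) (h : lebesgueType R -> R) ->
  (forall x, 0 <= x <= 1 -> 0 <= g x) ->
  (forall x, 0 <= x <= 1 -> 0 <= h x) ->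
  (integral01 g <= integral01 h + Lnorm01 1 (fun x => g x - h x)%R)%E.
Proof.
move=> mg mh g0 h0; rewrite Lnorm01_1 /integral01.
have mB : measurable_fun (@unit_itv R) (fun x : lebesgueType R => `|g x - h x|%:E).
  have mgh := measurable_funB mg mh.
  by apply/measurable_EFinP; exact: measurableT_comp.
have mhE : measurable_fun (@unit_itv R) (fun x : lebesgueType R => (h x)%:E).
  exact/measurable_EFinP.
rewrite -ge0_integralD//; last exact: measurable_unit_itv.
apply: ge0_le_integral.
- exact: measurable_unit_itv.
- by move=> x x01; rewrite lee_fin g0.
- exact/measurable_EFinP.
- exact: emeasurable_funD.
- move=> x _; rewrite -EFinD lee_fin -lerBlDl; exact: ler_norm.
Qed.

End int01_theory.

(** * Pointwise derivation rules and differentiation under the integral *)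

(** The derivation rules for functions written as abstractions, with the value of
    the derivative in the form that ring and field normalise. *)
Section real_derivation.
Context {R : realType}.
Implicit Types (f g : R -> R) (x a b c : R).

Lemma derD f g x a b : is_derive x 1 f a -> is_derive x 1 g b ->
  is_derive x 1 (fun y => f y + g y) (a + b).
Proof. by move=> df dg; exact: (is_deriveD df dg). Qed.

Lemma derB f g x a b : is_derive x 1 f a -> is_derive x 1 g b ->
  is_derive x 1 (fun y => f y - g y) (a - b).
Proof. by move=> df dg; exact: (is_deriveB df dg). Qed.

Lemma derM f g x a b : is_derive x 1 f a -> is_derive x 1 g b ->
  is_derive x 1 (fun y => f y * g y) (a * g x + f x * b).
Proof.
move=> df dg; have h := is_deriveM df dg; apply: (is_derive_eq h).
by rewrite /GRing.scale/= addrC [g x * a]mulrC.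
Qed.

Lemma derZ f x a c : is_derive x 1 f a -> is_derive x 1 (fun y => c * f y) (c * a).
Proof. by move=> df; exact: (is_deriveZ c df). Qed.

Lemma derV f x a : f x != 0 -> is_derive x 1 f a ->
  is_derive x 1 (fun y => (f y)^-1) (- a / f x ^+ 2).
Proof.
move=> fx0 df; have h := is_deriveV fx0 df; apply: (is_derive_eq h).
by rewrite /GRing.scale/= mulrC mulrN mulNr.
Qed.

Lemma derX f x a n : is_derive x 1 f a ->
  is_derive x 1 (fun y => f y ^+ n.+1) (n.+1%:R * f x ^+ n * a).
Proof.
move=> df; have h := is_deriveX n.+1 df.
by have -> : (fun y => f y ^+ n.+1) = f ^+ n.+1 by apply/funext => y;
  rewrite exprfctE.
Qed.

Lemma der_eq f x a b : is_derive x 1 f a -> a = b -> is_derive x 1 f b.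
Proof. by move=> df <-. Qed.

Lemma der_continuous f x a : is_derive x 1 f a -> {for x, continuous f}.
Proof.
by move=> df; apply/differentiable_continuous/derivable1_diffP; exact: ex_derive.
Qed.

Lemma derivable_der f x : derivable f x 1 -> is_derive x 1 f (derive1 f x).
Proof. by move=> df; apply: DeriveDef => //; rewrite derive1E. Qed.

End real_derivation.

Section continuous_pos_theory.
Context {R : realType}.
Implicit Types (g h : R -> R -> R) (t x : R).

Lemma continuous_pos_slice g t : continuous_pos g -> 0 < t -> continuous (g t).
Proof.
move=> cg t0 x.
apply: (@continuous_comp _ _ _ (fun y : R => (t, y)) (fun p : R * R => g p.1 p.2)).
  have c1 : (fun=> t) @ x --> t by exact: cvg_cst.
  exact: (cvg_pair c1 cvg_id).
exact: cg.
Qed.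

Lemma continuous_pos_indep (h : R -> R) : continuous h ->
  continuous_pos (fun _ x => h x).
Proof.
move=> ch t x t0; apply: (@continuous_comp _ _ _ (fun p : R * R => p.2) h).
  exact: cvg_snd.
exact: ch.
Qed.

Lemma continuous_posM g h : continuous_pos g -> continuous_pos h ->
  continuous_pos (fun t x => g t x * h t x).
Proof. by move=> cg ch t x t0; apply: cvgM; [exact: cg|exact: ch]. Qed.

Lemma continuous_posV g : (forall t x, 0 < t -> g t x != 0) -> continuous_pos g ->
  continuous_pos (fun t x => (g t x)^-1).
Proof. by move=> g0 cg t x t0; apply: cvgV; [exact: g0|exact: cg]. Qed.

Lemma continuous_pos_comp (phi : R -> R) g :
  (forall t x, 0 < t -> {for g t x, continuous phi}) -> continuous_pos g ->
  continuous_pos (fun t x => phi (g t x)).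
Proof.
move=> cphi cg t x t0.
apply: (@continuous_comp _ _ _ (fun p : R * R => g p.1 p.2) phi); first exact: cg.
exact: cphi.
Qed.

Lemma is_derive_int01 (g dg : R -> R -> R) (t : R) : 0 < t ->
  (forall s : R, 0 < s -> continuous (g s)) ->
  (forall s x : R, 0 < s -> is_derive s 1 (g^~ x) (dg s x)) ->
  continuous_pos dg ->
  is_derive t 1 (fun s => int01 (g s)) (int01 (dg t)).
Proof.
move=> t0 cg dgE cdg.
(* the dominating constant: dg is bounded on the compact [t/2, 2t] x [0,1] *)
have [M [_ HM]] : bounded_set
    [set dg p.1 p.2 | p in `[t / 2, t * 2]%classic `*` `[0%R, 1%R]%classic].
  apply: compact_bounded; apply: continuous_compact.
    apply: continuous_in_subspaceT => -[s x]; rewrite inE => -[/=].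
    rewrite in_itv/= => /andP[s0 _] _; apply: cdg.
    by rewrite (lt_le_trans _ s0)// divr_gt0.
  by apply: compact_setX; exact: segment_compact.
have {}HM s x : t / 2 <= s <= t * 2 -> 0 <= x <= 1 -> `|dg s x| <= `|M| + 1.
  move=> st x01; apply: (HM (`|M| + 1)).
    by rewrite (le_lt_trans (ler_norm _))// ltrDl.
  by exists (s, x) => //=; rewrite !in_itv.
have tI : `]t / 2, t * 2[%classic t.
  by rewrite /= in_itv/=; lra.
have Ipos s : `]t / 2, t * 2[%classic s -> 0 < s.
  by rewrite /= in_itv/=; lra.
have ig s : `]t / 2, t * 2[%classic s ->
    (@lebesgue_measure R).-integrable `[0%R, 1%R]%classic (EFin \o g s).
  by move=> /Ipos s0; apply: integrable01; exact: cg.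
have dgI (s : R) (x : measurableTypeR R) : `]t / 2, t * 2[%classic s -> `[0%R,
  1%R]%classic x ->
    derivable (g^~ x) s 1.
  by move=> /Ipos s0 _; have := dgE s x s0 => /(@ex_derive _ _ _ _ _ _ _).
have d1E s x : 0 < s -> partial1of2 g s x = dg s x.
  by move=> s0; rewrite partial1of2E; apply: (@derive_val _ _ _ _ _ _ _ (dgE s x s0)).
have iM : (@lebesgue_measure R).-integrable `[0%R, 1%R]%classic (EFin \o
  (fun=> `|M| + 1)).
  by apply: integrable01 => ?; exact: cvg_cst.
have boundI (s : R) (x : measurableTypeR R) : `]t / 2, t * 2[%classic s ->
  `[0%R, 1%R]%classic x ->
    `|partial1of2 g s x| <= `|M| + 1.
  move=> sI; have s0 := Ipos _ sI; rewrite d1E//.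
  move: sI; rewrite /= !in_itv/= => /andP[s1 s2]; apply: HM.
  by rewrite !ltW.
have M0 (y : measurableTypeR R) : 0 <= `|M| + 1 by rewrite addr_ge0.
have mI : measurable (`[0%R, 1%R]%classic : set (measurableTypeR R)) by [].
apply: DeriveDef.
  exact: (derivable_under_integral mI tI ig dgI M0 iM boundI).
rewrite -derive1E.
rewrite (differentiation_under_integral mI tI ig dgI M0 iM boundI).
by apply: eq_int01 => x _; exact: d1E.
Qed.

End continuous_pos_theory.

(** * Poincare inequality and the positive part *)

Section poincare.
Context {R : realType}.
Notation mu := (@lebesgue_measure R).
Implicit Types (u du : R -> R).

(** Integrate 0 <= (du - s) ^ 2 over [a, b] and use b - a <= 1.  Keeping s free
    replaces the Cauchy-Schwarz inequality: the optimal s is chosen by the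
    caller. *)
Lemma oscillation_le_energy u du (s a b : R) :
  (forall x : R, is_derive x 1 u (du x)) -> continuous du ->
  0 <= a -> a <= b -> b <= 1 ->
  2 * s * (u b - u a) <= int01 (fun x => du x ^+ 2) + s ^+ 2.
Proof.
move=> dE cdu a0; rewrite le_eqVlt => /predU1P[<- _|ab b1].
  rewrite subrr mulr0 addr_ge0 ?sqr_ge0// int01_ge0// => x _.
  exact: sqr_ge0.
have cdu2 : continuous (fun x => du x ^+ 2) by move=> x; apply: cvgM; exact: cdu.
have cf : continuous (fun x => 2 * s * du x - s ^+ 2).
  move=> x; apply: cvgB; last exact: cvg_cst.
  by apply: cvgM; [exact: cvg_cst|exact: cdu].
pose F x := 2 * s * u x - s ^+ 2 * x.
have dF (x : R) : is_derive x 1 F (2 * s * du x - s ^+ 2).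
  apply: (der_eq (derB (derZ (2 * s) (dE x)) (derZ (s ^+ 2) (is_derive_id x 1)))).
  by rewrite mulr1.
have cF (x : R) : F y @[y --> x] --> F x by exact: der_continuous (dF x).
have FTC : (\int[mu]_(x in `[a, b]) (2 * s * du x - s ^+ 2)%:E)%E =
  ((F b)%:E - (F a)%:E)%E.
  apply: continuous_FTC2 => //.
  - exact: continuous_subspaceT.
  - split; first by move=> x _; exact: ex_derive.
      exact/cvg_at_right_filter/cF.
    exact/cvg_at_left_filter/cF.
  - by move=> x _; rewrite derive1E; exact: derive_val.
have : F b - F a <= int01 (fun x => du x ^+ 2).
  rewrite -lee_fin EFinB -FTC int01E//.
  have sub : `[a, b]%classic `<=` `[0%R, 1%R]%classic.
    by apply: subset_itv; rewrite bnd_simp.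
  apply: (@le_trans _ _ (\int[mu]_(x in `[a, b]) (du x ^+ 2)%:E)%E).
    apply: le_integral => //.
    - apply: continuous_compact_integrable; first exact: segment_compact.
      exact: continuous_subspaceT.
    - by apply: integrableS (integrable01 cdu2).
    - move=> x _; rewrite lee_fin -subr_ge0.
      by have := sqr_ge0 (du x - s); lra.
  apply: ge0_subset_integral => //.
    by apply/measurable_EFinP; apply/measurable_funTS;
      exact: continuous_measurable_fun.
  by move=> x _; rewrite lee_fin sqr_ge0.
rewrite /F => H.
have : s ^+ 2 * (b - a) <= s ^+ 2 * 1 by apply: ler_wpM2l; [exact: sqr_ge0|lra].
lra.
Qed.

(** With s = u x, the oscillation bound reads
    2 u(x) (u(x) - u(y)) <= D + u(x) ^ 2, D the Dirichlet energy.  Integrated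
    in y against m, the term u(y) disappears and D >= u(x) ^ 2 remains. *)
Lemma sqr_le_energy (m u du : R -> R) : continuous m ->
  (forall x, 0 <= x <= 1 -> 0 <= m x) -> 0 < int01 m ->
  (forall x : R, is_derive x 1 u (du x)) -> continuous du ->
  int01 (fun x => m x * u x) = 0 ->
  forall x, 0 <= x <= 1 -> u x ^+ 2 <= int01 (fun x => du x ^+ 2).
Proof.
move=> cm m0 im0 dE cdu mean0 x x01.
set D := int01 _.
have cu : continuous u.
  by move=> y; exact: der_continuous (dE y).
have osc y : 0 <= y <= 1 -> 2 * u x * (u x - u y) <= D + u x ^+ 2.
  move=> y01; have [xy|/ltW yx] := leP x y.
  - have := @oscillation_le_energy u du (- u x) x y dE cdu.
    rewrite -/D sqrrN; move=> /(_ _ _ _); lra.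
  - have := @oscillation_le_energy u du (u x) y x dE cdu.
    rewrite -/D; move=> /(_ _ _ _); lra.
have : 0 <= int01 (fun y => (D - u x ^+ 2) * m y + 2 * u x * (m y * u y)).
  apply: int01_ge0 => y y01.
  have -> : (D - u x ^+ 2) * m y + 2 * u x * (m y * u y) =
     m y * (D + u x ^+ 2 - 2 * u x * (u x - u y)) by ring.
  by rewrite mulr_ge0 ?m0// subr_ge0 osc.
have cmu : continuous (fun y => m y * u y) by move=> y; apply: cvgM;
  [exact: cm|exact: cu].
rewrite int01D; last 2 first.
- by move=> y; apply: cvgM; [exact: cvg_cst|exact: cm].
- by move=> y; apply: cvgM; [exact: cvg_cst|exact: cmu].
by rewrite !int01Z// mean0 mulr0 addr0 pmulr_lge0// subr_ge0.
Qed.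

End poincare.

Section positive_part.
Context {R : realType}.
Definition pos_part (x : R) : R := Num.max x 0.

Lemma pos_part_ge0 x : 0 <= pos_part x.
Proof. by rewrite /pos_part le_max lexx orbT. Qed.

Lemma pos_part_id x : 0 <= x -> pos_part x = x.
Proof. by move=> x0; rewrite /pos_part max_l. Qed.

Lemma pos_part_eq0 x : x <= 0 -> pos_part x = 0.
Proof. by move=> x0; rewrite /pos_part max_r. Qed.

Lemma pos_partP x : (pos_part x = x /\ 0 <= x) \/ (pos_part x = 0 /\ x <= 0).
Proof.
have [x0|/ltW x0] := leP 0 x; [left|right]; split=> //.
- exact: pos_part_id.
- exact: pos_part_eq0.
Qed.

(** The remainder of the first-order expansion is at most h ^ 2 in absolute
    value, whatever the signs of x and x + h. *)
Lemma is_derive_pos_part2 (x : R) :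
  is_derive x 1 (fun y => pos_part y ^+ 2) (2 * pos_part x).
Proof.
suff H : h^-1 *: (((fun y => pos_part y ^+ 2) \o shift x) (h *: 1) - pos_part x ^+ 2)
     @[h --> 0^'] --> 2 * pos_part x.
  by apply: DeriveDef; [apply/cvg_ex; exists (2 * pos_part x)|exact/cvg_lim].
apply/cvgrPdist_le => /= e e0.
near=> h.
have h0 : h != 0 by near: h; exact: nbhs_dnbhs_neq.
have he : `|h| <= e.
  near: h; apply/nbhs_dnbhs; near do rewrite -[X in `|X|]subr0 distrC.
  exact: cvgr_dist_le.
rewrite /GRing.scale/= mulr1.
have -> : 2 * pos_part x - h^-1 * (pos_part (h + x) ^+ 2 - pos_part x ^+ 2) =
  - (h^-1 * (pos_part (h + x) ^+ 2 - pos_part x ^+ 2 - 2 * pos_part x * h)) by field.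
rewrite normrN normrM normfV ler_pdivrMl ?normr_gt0//.
apply: (@le_trans _ _ (`|h| * `|h|)); last exact: ler_wpM2l.
rewrite -expr2 -normrX ler_norml.
rewrite (@ger0_norm _ (h^+2)) ?sqr_ge0//.
have [[-> ?]|[-> ?]] := pos_partP x; have [[-> ?]|[-> ?]] := pos_partP (h + x);
  apply/andP; split; nra.
Unshelve. all: by end_near. Qed.

Lemma is_derive_pos_part3 (x : R) :
  is_derive x 1 (fun y => pos_part y ^+ 3) (3 * pos_part x ^+ 2).
Proof.
have -> : (fun y => pos_part y ^+ 3) = (fun y => pos_part y ^+ 2 * y).
  by apply/funext => y; have [[-> _]|[-> _]] := pos_partP y; ring.
apply: (der_eq (derM (is_derive_pos_part2 x) (is_derive_id x 1))).
have [[-> _]|[-> _]] := pos_partP x; ring.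
Qed.

Lemma continuous_pos_part : continuous pos_part.
Proof.
move=> x; apply: continuous_max; [exact: cvg_id|exact: cvg_cst].
Qed.

End positive_part.

(** * Entropy dissipation *)

Lemma derive1_periodic (R : realType) (g : R -> R) (T : R) :
  periodic g T -> periodic (derive1 g) T.
Proof.
move=> gT x; rewrite /derive1.
suff -> : (fun h => h^-1 *: (g (h + (x + T)) - g (x + T))) =
          (fun h => h^-1 *: (g (h + x) - g x)) by [].
by apply/funext => h; rewrite addrA !gT.
Qed.

(** The stationary solution, up to the normalising constant. *)
Definition equilibrium (R : realType) (r : R) (rho : R -> R) (x : R) : R :=
  rho x `^ (r + 1)^-1.

Definition relative_density (R : realType) (r : R) (rho : R -> R)
    (f : R -> R -> R) (t x : R) : R :=
  f t x / equilibrium r rho x.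

(** The diffusion coefficient of the equation in divergence form for the
    relative density; it equals m * u ^ - (r + 1). *)
Definition mobility (R : realType) (r : R) (rho : R -> R)
    (f : R -> R -> R) (t x : R) : R :=
  f t x * relative_density r rho f t x `^ (- (r + 1) - 1).

Definition entropy (R : realType) (r : R) (rho : R -> R)
    (f : R -> R -> R) (phi : R -> R) (t : R) : R :=
  int01 (fun x => equilibrium r rho x * phi (relative_density r rho f t x)).

Section entropy.
Context {R : realType} {r alpha : R} {rho : R -> R} {f : R -> R -> R}.
Context (r0 : 0 < r).
Context (rho0 : forall x, 0 < rho x).
Context (rho1 : periodic rho 1).
Context (rhoC2 : C2_holder alpha rho).
Context (fsol : solution r alpha rho f).

Notation m := (equilibrium r rho).
Let dm (x : R) := (r + 1)^-1 * rho x `^ ((r + 1)^-1 - 1) * derive1 rho x.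
Notation u := (relative_density r rho f).
Notation a := (mobility r rho f).
Let du (t x : R) := derive1 (f t) x * (m x)^-1 + f t x * (- dm x / m x ^+ 2).
Let P (t z : R) := rho z / f t z `^ (r + 1).
Let G (t y : R) := f t y * derive1 (P t) y.

Lemma equilibrium_gt0 x : 0 < m x.
Proof. by rewrite /equilibrium powR_gt0. Qed.

Let m_neq0 x : m x != 0. Proof. by rewrite gt_eqF// equilibrium_gt0. Qed.

Let der_m (x : R) : is_derive x 1 m (dm x).
Proof.
have [drho _ _] := rhoC2.
exact: (is_derive1_comp (is_derive1_powR _ (rho0 x)) (derivable_der (drho x))).
Qed.

Lemma continuous_equilibrium : continuous m.
Proof. by move=> x; exact: der_continuous (der_m x). Qed.

Let derivable_dm (x : R) : derivable dm x 1.
Proof.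
have [drho ddrho _] := rhoC2.
have h := derM (derZ (r + 1)^-1 (is_derive1_comp (is_derive1_powR
  ((r + 1)^-1 - 1) (rho0 x)) (derivable_der (drho x))))
  (derivable_der (ddrho x)).
exact: ex_derive.
Qed.

Lemma relative_density_gt0 t x : 0 <= t -> 0 < u t x.
Proof. by move=> t0; rewrite divr_gt0 ?equilibrium_gt0//; exact: (sol_gt0 fsol). Qed.

Let der_f (t x : R) : 0 < t -> is_derive x 1 (f t) (derive1 (f t) x).
Proof.
by move=> t0; have [df _ _] := sol_C2_holder fsol t0; exact: derivable_der.
Qed.

Let der_u (t x : R) : 0 < t -> is_derive x 1 (u t) (du t x).
Proof.
by move=> t0; exact: (derM (der_f x t0) (derV (m_neq0 x) (der_m x))).
Qed.

(** The flux G involves du, so its differentiability in x, required before the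
    equation can be integrated by parts, rests on this one; continuity of the
    derivative of G then follows from the equation and the continuity of the
    time derivative of f. *)
Let derivable_du (t x : R) : 0 < t -> derivable (du t) x 1.
Proof.
move=> t0; have [_ ddf _] := sol_C2_holder fsol t0.
have h1 := derM (derivable_der (ddf x)) (derV (m_neq0 x) (der_m x)).
have m20 : m x ^+ 2 != 0 by rewrite expf_neq0.
have h2 := derM (derZ (-1) (derivable_der (@derivable_dm x))) (@derV _
  (fun y => m y ^+ 2) x _ m20 (derX 1 (der_m x))).
have h := derD h1 (derM (der_f x t0) h2).
have -> : du t = (fun y => derive1 (f t) y * (m y)^-1 +
    f t y * (-1 * dm y * (m y ^+ 2)^-1)).
  by apply/funext => y; rewrite /du mulN1r.
exact: ex_derive.
Qed.

(** The pressure rho / f ^ (r + 1) depends on u only, which is what turns the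
    equation into a diffusion for u. *)
Let PE (t : R) : 0 < t -> P t = (fun z => u t z `^ (- (r + 1))).
Proof.
move=> t0; apply/funext => z; rewrite /P powRN.
have f0 : 0 < f t z by apply: (sol_gt0 fsol); exact: ltW.
have r10 : r + 1 != 0 by rewrite gt_eqF// addr_gt0.
have mE : m z `^ (r + 1) = rho z.
  by rewrite /equilibrium -powRrM mulVf// powRr1// ltW.
have fE : f t z `^ (r + 1) = u t z `^ (r + 1) * rho z.
  rewrite -[in RHS]mE -powRM ?divfK//; apply: ltW.
    by rewrite relative_density_gt0// ltW.
  exact: equilibrium_gt0.
rewrite fE invfM mulrCA divff ?mulr1// gt_eqF//.
Qed.

Let der_P (t x : R) : 0 < t ->
  is_derive x 1 (P t) (- (r + 1) * u t x `^ (- (r + 1) - 1) * du t x).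
Proof.
move=> t0; rewrite PE//; have u0 := relative_density_gt0 x (ltW t0).
exact: (is_derive1_comp (is_derive1_powR _ u0) (der_u x t0)).
Qed.

Let GE (t : R) : 0 < t -> G t = (fun x => - (r + 1) * (a t x * du t x)).
Proof.
move=> t0; apply/funext => x; rewrite /G derive1E.
have -> := @derive_val _ _ _ _ _ _ _ (der_P x t0).
rewrite /mobility; ring.
Qed.

Let der_a (t x : R) : 0 < t -> exists c, is_derive x 1 (a t) c.
Proof.
move=> t0; have u0 := relative_density_gt0 x (ltW t0); eexists.
exact: (derM (der_f x t0) (is_derive1_comp (is_derive1_powR _ u0) (der_u x t0))).
Qed.

Let derivable_G (t x : R) : 0 < t -> derivable (G t) x 1.
Proof.
move=> t0; rewrite GE//; have [c ha] := der_a x t0.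
have h := derZ (- (r + 1)) (derM ha (derivable_der (@derivable_du t x t0))).
exact: ex_derive.
Qed.

Let G01 (t : R) : 0 < t -> G t 1 = G t 0.
Proof.
move=> t0; rewrite /G.
have ft1 := sol_periodic fsol (ltW t0).
have P1 : periodic (P t) 1 by move=> x; rewrite /P ft1 rho1.
by have := ft1 0; have := derive1_periodic P1 0; rewrite !add0r => -> ->.
Qed.

Let u01 (t : R) : 0 < t -> u t 1 = u t 0.
Proof.
move=> t0; have := rho1 0; have := sol_periodic fsol (ltW t0) 0.
by rewrite !add0r /relative_density /equilibrium => -> ->.
Qed.

Let cdu (t : R) : 0 < t -> continuous (du t).
Proof.
by move=> t0 x; exact: der_continuous (derivable_der (@derivable_du t x t0)).
Qed.

Lemma continuous_mobility (t : R) : 0 < t -> continuous (a t).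
Proof. by move=> t0 x; have [c ha] := der_a x t0; exact: der_continuous ha. Qed.

Lemma continuous_relative_density (t : R) : 0 < t -> continuous (u t).
Proof. by move=> t0 x; exact: der_continuous (der_u x t0). Qed.

Let continuous_pos_u : continuous_pos u.
Proof.
apply: continuous_posM; first exact: (sol_continuous fsol).
apply: continuous_posV; first by move=> *; exact: m_neq0.
apply: continuous_pos_indep; exact: continuous_equilibrium.
Qed.

Let derive1_u (t : R) : 0 < t -> derive1 (u t) = du t.
Proof.
move=> t0; apply/funext => x; rewrite derive1E.
exact: (@derive_val _ _ _ _ _ _ _ (der_u x t0)).
Qed.

Lemma is_derive_relative_density (t x : R) : 0 < t ->
  is_derive x 1 (u t) (derive1 (u t) x).
Proof. by move=> t0; rewrite derive1_u//; exact: der_u. Qed.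

Lemma continuous_derive1_relative_density (t : R) : 0 < t ->
  continuous (derive1 (u t)).
Proof. by move=> t0; rewrite derive1_u//; exact: cdu. Qed.

(** Differentiating under the integral gives int dphi(u) f_t, and f_t = - r G_x.
    The total derivative of dphi(u) G integrates to zero over a period, leaving
    r int ddphi(u) u_x G with G = - (r + 1) a u_x. *)
Lemma is_derive_entropy (phi dphi ddphi : R -> R) (t : R) :
  (forall v : R, 0 < v -> is_derive v 1 phi (dphi v)) ->
  (forall v : R, 0 < v -> is_derive v 1 dphi (ddphi v)) ->
  (forall v : R, 0 < v -> {for v, continuous ddphi}) -> 0 < t ->
  is_derive t 1 (entropy r rho f phi)
   (- (r * (r + 1)) *
    int01 (fun x => ddphi (u t x) * (a t x * derive1 (u t) x ^+ 2))).
Proof.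
move=> dphiE ddphiE cddphi t0; rewrite derive1_u//.
pose dtf t x := derive1 (f^~ x) t.
have u0 s x : 0 < s -> 0 < u s x by move=> s0; exact/relative_density_gt0/ltW.
have cdphi v : 0 < v -> {for v, continuous dphi}.
  by move=> v0; exact: der_continuous (ddphiE v v0).
have step1 : is_derive t 1 (entropy r rho f phi) (int01 (fun x => dphi
  (u t x) * dtf t x)).
  apply: (@is_derive_int01 _ (fun t x => m x * phi (u t x)) (fun t x => dphi
    (u t x) * dtf t x)) => //.
  - move=> s s0 x; apply: cvgM; first exact: continuous_equilibrium.
    apply: (@continuous_comp _ _ _ (u s) phi);
      first exact: continuous_relative_density.
    exact: der_continuous (dphiE _ (u0 _ _ s0)).
  - move=> s x s0.
    have dtfE := derivable_der (@sol_derivable_t _ _ _ _ _ fsol s x s0).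
    have dut : is_derive s 1 (u^~ x) ((m x)^-1 * dtf s x).
      have -> : u^~ x = (fun t => (m x)^-1 * f t x).
        by apply/funext => t'; rewrite /relative_density mulrC.
      exact: derZ.
    have h : is_derive s 1 (fun t => m x * phi (u t x)) _ :=
      derZ (m x) (@is_derive1_comp _ phi (u^~ x) s _ _ (dphiE _ (u0 s x s0)) dut).
    apply: (der_eq h).
    by rewrite mulrCA mulVKf.
  - apply: continuous_posM; last exact: (sol_continuous_dt fsol).
    by apply: continuous_pos_comp continuous_pos_u => s x s0; exact/cdphi/u0.
apply: (der_eq step1).
have cF : continuous (fun x => ddphi (u t x) * (a t x * du t x ^+ 2)).
  move=> x; apply: cvgM.
    apply: (@continuous_comp _ _ _ (u t) ddphi);
      first exact: continuous_relative_density.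
    exact/cddphi/u0.
  by apply: cvgM; [exact: continuous_mobility|apply: cvgM; exact: cdu].
have cdt : continuous (fun x => dphi (u t x) * dtf t x).
  move=> x; apply: cvgM; last exact: (continuous_pos_slice (sol_continuous_dt
    fsol) t0).
  apply: (@continuous_comp _ _ _ (u t) dphi);
    first exact: continuous_relative_density.
  exact/cdphi/u0.
have dQ (x : R) : is_derive x 1 (fun y => - r * (dphi (u t y) * G t y))
    (r * (r + 1) * (ddphi (u t x) * (a t x * du t x ^+ 2)) + dphi (u t x) * dtf t x).
  have dG := derivable_der (@derivable_G t x t0).
  have h : is_derive x 1 (fun y => - r * (dphi (u t y) * G t y)) _ :=
    derZ (- r) (derM (is_derive1_comp (ddphiE _ (u0 t x t0)) (der_u x t0)) dG).
  apply: (der_eq h).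
  rewrite /dtf (sol_eq fsol)// -/(G t) GE//=. ring.
have cR : continuous (fun x => r * (r + 1) * (ddphi (u t x) * (a t x * du t x ^+ 2))).
  by move=> x; apply: cvgM; [exact: cvg_cst|exact: cF].
have := int01_derive _ dQ; rewrite G01// u01// subrr int01D// int01Z//.
have cRD : continuous (fun x =>
    r * (r + 1) * (ddphi (u t x) * (a t x * du t x ^+ 2)) + dphi (u t x) * dtf t x).
  by move=> x; apply: cvgD; [exact: cR|exact: cdt].
by move=> /(_ cRD); lra.
Qed.

Lemma le_entropy (phi dphi ddphi : R -> R) (s t : R) :
  (forall v : R, 0 < v -> is_derive v 1 phi (dphi v)) ->
  (forall v : R, 0 < v -> is_derive v 1 dphi (ddphi v)) ->
  (forall v : R, 0 < v -> {for v, continuous ddphi}) ->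
  (forall v : R, 0 < v -> 0 <= ddphi v) ->
  0 < s -> s <= t -> entropy r rho f phi t <= entropy r rho f phi s.
Proof.
move=> dphiE ddphiE cddphi ddphi0 s0 st.
have dE x : 0 < x -> _ := @is_derive_entropy phi dphi ddphi x dphiE ddphiE cddphi.
apply: (@ler0_derive1_nincr _ _ s t) => //.
- move=> x; rewrite in_itv/= => /andP[sx _].
  by have := dE x (lt_trans s0 sx) => ?; exact: ex_derive.
- move=> x; rewrite in_itv/= => /andP[sx _].
  have x0 := lt_trans s0 sx.
  rewrite derive1E (@derive_val _ _ _ _ _ _ _ (dE x x0)) mulNr oppr_le0.
  apply: mulr_ge0; first by rewrite mulr_ge0// ?addr_ge0// ltW.
  apply: int01_ge0 => y _; have u0 := relative_density_gt0 y (ltW x0).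
  rewrite mulr_ge0 ?ddphi0// mulr_ge0 ?sqr_ge0// mulr_ge0 ?powR_ge0//.
  by rewrite ltW// (sol_gt0 fsol)// ltW.
- apply: derivable_within_continuous => x; rewrite in_itv/= => /andP[sx _].
  by have := dE x (lt_le_trans s0 sx) => ?; exact: ex_derive.
Qed.

End entropy.

(** * Truncated entropies and exponential decay *)

Section truncated_entropies.
Context {R : realType}.
Implicit Types k v w : R.

(** The third power makes this convex function of class C^2; it vanishes exactly
    on [k, +oo). *)
Definition below (k v : R) : R := pos_part (k - v) ^+ 3.

(** Dividing the cube by v ^ 2 keeps the growth linear at infinity without losing
    the convexity, by [is_derive2_above]; the function is of class C^2 and
    vanishes exactly on (0, k]. *)
Definition above (k v : R) : R := pos_part (v - k) ^+ 3 / v ^+ 2.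

Let der_shift k v : is_derive v 1 (fun y : R => y - k) 1.
Proof.
have h := derB (is_derive_id v 1) (is_derive_cst k v 1).
by apply: (der_eq h); rewrite subr0.
Qed.

Let der_flip k v : is_derive v 1 (fun y : R => k - y) (-1).
Proof.
have h := derB (is_derive_cst k v 1) (is_derive_id v 1).
by apply: (der_eq h); rewrite sub0r.
Qed.

Lemma is_derive_below k v :
  is_derive v 1 (below k) (- 3 * pos_part (k - v) ^+ 2).
Proof.
have h := @is_derive1_comp _ (fun y => pos_part y ^+ 3) (fun y => k - y) v _ _
  (is_derive_pos_part3 (k - v)) (der_flip k v).
by apply: (der_eq h); ring.
Qed.

Lemma is_derive2_below k v :
  is_derive v 1 (fun y => - 3 * pos_part (k - y) ^+ 2) (6 * pos_part (k - v)).
Proof.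
have h := derZ (- 3) (@is_derive1_comp _ (fun y => pos_part y ^+ 2)
  (fun y => k - y) v _ _ (is_derive_pos_part2 (k - v)) (der_flip k v)).
by apply: (der_eq h); ring.
Qed.

(** On v >= 0 the positive part of k - v is at most k, so the cube is
    Lipschitz there. *)
Lemma below_le k v w : 0 <= k -> 0 <= v -> k <= w -> below k v <= k ^+ 2 * `|v - w|.
Proof.
move=> k0 v0 kw; have := ler_norm (- (v - w)); rewrite normrN /below.
move: `|v - w| (normr_ge0 (v - w)) => d d0 dvw.
have [[-> h]|[-> h]] := pos_partP (k - v); last by rewrite expr0n/= mulr_ge0 ?sqr_ge0.
rewrite exprSr; apply: ler_pM; [exact: sqr_ge0|exact: h| |lra].
by rewrite ler_sqr ?nnegrE//; lra.
Qed.

Lemma is_derive_above k v : 0 < v -> is_derive v 1 (above k)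
  (3 * pos_part (v - k) ^+ 2 / v ^+ 2 - 2 * pos_part (v - k) ^+ 3 / v ^+ 3).
Proof.
move=> v0; have v_neq0 : v != 0 by rewrite gt_eqF.
have v2_neq0 : v ^+ 2 != 0 by rewrite expf_neq0.
have d3 := @is_derive1_comp _ (fun y => pos_part y ^+ 3) (fun y => y - k) v _ _
  (is_derive_pos_part3 (v - k)) (der_shift k v).
have h := derM d3 (@derV _ (fun y : R => y ^+ 2) v _ v2_neq0 (derX 1
  (is_derive_id v 1))).
by apply: (der_eq h) => /=; field.
Qed.

Lemma is_derive2_above k v : 0 < v ->
  is_derive v 1 (fun y => 3 * pos_part (y - k) ^+ 2 / y ^+ 2 - 2 * pos_part
    (y - k) ^+ 3 / y ^+ 3)
  (6 * pos_part (v - k) * (v - pos_part (v - k)) ^+ 2 / v ^+ 4).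
Proof.
move=> v0; have v_neq0 : v != 0 by rewrite gt_eqF.
have v2_neq0 : v ^+ 2 != 0 by rewrite expf_neq0.
have v3_neq0 : v ^+ 3 != 0 by rewrite expf_neq0.
have d2 := @is_derive1_comp _ (fun y => pos_part y ^+ 2) (fun y => y - k) v _ _
  (is_derive_pos_part2 (v - k)) (der_shift k v).
have d3 := @is_derive1_comp _ (fun y => pos_part y ^+ 3) (fun y => y - k) v _ _
  (is_derive_pos_part3 (v - k)) (der_shift k v).
have h2 := derM (derZ 3 d2) (@derV _ (fun y : R => y ^+ 2) v _ v2_neq0 (derX 1
  (is_derive_id v 1))).
have h3 := derM (derZ 2 d3) (@derV _ (fun y : R => y ^+ 3) v _ v3_neq0 (derX 2
  (is_derive_id v 1))).
have h := derB h2 h3.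
by apply: (der_eq h) => /=; field.
Qed.

Lemma continuous_derive2_above k v : 0 < v ->
  {for v, continuous (fun y =>
    6 * pos_part (y - k) * (y - pos_part (y - k)) ^+ 2 / y ^+ 4)}.
Proof.
move=> v0.
have cp : {for v, continuous (fun y => pos_part (y - k))}.
  apply: (@continuous_comp _ _ _ (fun y => y - k) (@pos_part R));
    last exact: continuous_pos_part.
  exact: der_continuous (der_shift k v).
have cB : {for v, continuous (fun y => y - pos_part (y - k))}.
  by apply: cvgB; [exact: cvg_id|exact: cp].
apply: cvgM; first apply: cvgM.
- by apply: cvgM; [exact: cvg_cst|exact: cp].
- by apply: cvgM; exact: cB.
- apply: cvgV; first by rewrite expf_neq0// gt_eqF.
  exact: der_continuous (derX 3 (is_derive_id v 1)).
Qed.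

Lemma above_ge0 k v : 0 <= above k v.
Proof. by rewrite /above divr_ge0 ?sqr_ge0// exprn_ge0// pos_part_ge0. Qed.

Lemma above_le k v w : 0 <= k -> 0 < v -> w <= k -> above k v <= `|v - w|.
Proof.
move=> k0 v0 wk; have := ler_norm (v - w); rewrite /above.
move: `|v - w| (normr_ge0 (v - w)) => d d0 dvw.
have [[-> h]|[-> h]] := pos_partP (v - k); last by rewrite expr0n/= mul0r.
rewrite ler_pdivrMr ?exprn_gt0// exprSr mulrC.
apply: ler_pM; [exact: h|exact: sqr_ge0|lra|].
by rewrite ler_sqr ?nnegrE//; lra.
Qed.

End truncated_entropies.

(** Gronwall's argument started at time 1, where y <= B is known; for t <= 1 the
    factor expR c absorbs the exponential.  Nothing ties y(0) to the values at
    small positive times, hence the start at 1. *)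
Lemma exponential_decay (R : realType) (y dy : R -> R) (c B : R) :
  0 <= c -> 0 <= B ->
  (forall t : R, 0 < t -> is_derive t 1 y (dy t)) ->
  (forall t : R, 0 < t -> dy t <= - c * y t) ->
  (forall t : R, 0 < t -> y t <= B) ->
  forall t : R, 0 < t -> y t <= B * expR c * expR (- c * t).
Proof.
move=> c0 B0 dE dle yB t t0.
have [t1|t1] := leP t 1.
  apply: (le_trans (yB t t0)); rewrite -mulrA ler_peMr// -expRD.
  rewrite -expR0 ler_expR; nra.
pose z s := y s * expR (c * s).
have dz (s : R) : 0 < s ->
    is_derive s 1 z (dy s * expR (c * s) + y s * (expR (c * s) * c)).
  move=> s0; have he := @is_derive1_comp _ expR (fun s => c * s) s _ _
    (is_derive_expR _) (derZ c (is_derive_id s 1)).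
  by apply: (der_eq (derM (dE s s0) he)); rewrite mulr1.
have : z t <= z 1.
  apply: (@ler0_derive1_nincr _ z 1 t) => //.
  - move=> s; rewrite in_itv/= => /andP[s1 _].
    by have := dz s (lt_trans ltr01 s1) => ?; exact: ex_derive.
  - move=> s; rewrite in_itv/= => /andP[s1 _].
    have s0 := lt_trans ltr01 s1.
    rewrite derive1E (@derive_val _ _ _ _ _ _ _ (dz s s0)).
    have -> : dy s * expR (c * s) + y s * (expR (c * s) * c) =
       (dy s + c * y s) * expR (c * s) by ring.
    rewrite pmulr_lle0 ?expR_gt0//; have := dle s s0; lra.
  - apply: derivable_within_continuous => s; rewrite in_itv/= => /andP[s1 _].
    by have := dz s (lt_le_trans ltr01 s1) => ?; exact: ex_derive.
  - exact: ltW.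
rewrite /z mulr1 => zt.
rewrite mulNr expRN ler_pdivlMr ?expR_gt0//.
apply: (le_trans zt); rewrite ler_pM2r ?expR_gt0//; exact: yB.
Qed.

(** * Maximum principle and conservation of mass *)

Lemma le_of_cvg0_right (R : realType) (D : R -> \bar R) (b c L t : R) :
  D s @[s --> 0^'+] --> 0%E -> 0 < t ->
  (forall s, 0 < s -> s <= t -> (b%:E <= c%:E + L%:E * D s)%E) -> b <= c.
Proof.
move=> D0 t0 bD.
have lim : (c%:E + L%:E * D s)%E @[s --> 0^'+] --> (c%:E + L%:E * 0)%E.
  apply: cvgeD; first by rewrite mule0.
    exact: cvg_cst.
  exact: cvgeZl.
rewrite mule0 adde0 in lim.
rewrite -lee_fin; apply: (cvge_to_ge lim).
near=> s; apply: bD; first by near: s; exact: nbhs_right_gt.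
by near: s; exact: nbhs_right_le.
Unshelve. all: by end_near. Qed.

Section convergence.
Context {R : realType} {r alpha : R} {rho : R -> R} {f : R -> R -> R}.
Context (r0 : 0 < r).
Context (rho0 : forall x, 0 < rho x).
Context (rho1 : periodic rho 1).
Context (rhoC2 : C2_holder alpha rho).
Context (fsol : solution r alpha rho f).
Context (f0dens : prob_density (f 0)).

Notation m := (equilibrium r rho).
Notation u := (relative_density r rho f).
Notation D s := (Lnorm01 1 (fun x => f s x - f 0 x)).

Let mE : continuous m := continuous_equilibrium rho0 rhoC2.
Let m0 x : 0 < m x := @equilibrium_gt0 _ r _ rho0 x.
Let u0 t x (t0 : 0 < t) : 0 < u t x :=
  @relative_density_gt0 _ _ _ _ _ rho0 fsol t x (ltW t0).
Let cu t (t0 : 0 < t) : continuous (u t) :=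
  continuous_relative_density rho0 rhoC2 fsol t0.

Let mf t (t0 : 0 < t) : measurable_fun (@unit_itv R) (f t : lebesgueType R -> R).
Proof. apply: measurable_lebesgue; exact: (continuous_pos_slice (sol_continuous
  fsol) t0). Qed.

Let mf0 : measurable_fun (@unit_itv R) (f 0 : lebesgueType R -> R).
Proof. by have [] := f0dens. Qed.

Let fE t x : f t x = m x * u t x.
Proof. by rewrite /relative_density mulrC divfK// gt_eqF. Qed.

Let continuous_entropy_density (phi dphi : R -> R) t : 0 < t ->
  (forall v : R, 0 < v -> is_derive v 1 phi (dphi v)) ->
  continuous (fun x => m x * phi (u t x)).
Proof.
move=> t0 dphiE x; apply: cvgM; first exact: mE.
apply: (@continuous_comp _ _ _ (u t) phi); first exact: cu.
exact: der_continuous (dphiE _ (u0 x t0)).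
Qed.

(** By monotonicity the entropy at time t is at most its value at any earlier s,
    which is at most L times the L^1 distance of f(s) to f(0): multiplying
    |u(s) - u(0)| by m gives |f(s) - f(0)|.  This distance tends to 0. *)
Lemma entropy_vanishes (phi dphi ddphi : R -> R) (lo hi L : R) :
  (forall v : R, 0 < v -> is_derive v 1 phi (dphi v)) ->
  (forall v : R, 0 < v -> is_derive v 1 dphi (ddphi v)) ->
  (forall v : R, 0 < v -> {for v, continuous ddphi}) ->
  (forall v : R, 0 < v -> 0 <= ddphi v) ->
  (forall v : R, 0 < v -> 0 <= phi v) -> 0 <= L ->
  (forall v w : R, 0 < v -> lo <= w <= hi -> phi v <= L * `|v - w|) ->
  (forall x, 0 <= x <= 1 -> lo <= u 0 x <= hi) ->
  forall t x : R, 0 < t -> 0 <= x <= 1 -> phi (u t x) = 0.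
Proof.
move=> dphiE ddphiE cddphi ddphi0 phi0 L0 phiL u0b t x t0 x01.
have cE := continuous_entropy_density t0 dphiE.
have Epos y : 0 <= m y * phi (u t y) by rewrite mulr_ge0 ?phi0 ?u0// ltW.
have E0 : int01 (fun y => m y * phi (u t y)) = 0.
  apply/eqP; rewrite eq_le int01_ge0 ?andbT//.
  apply: (@le_of_cvg0_right _ (fun s => D s) _ _ L t (sol_init fsol) t0) => s s0 st.
  rewrite add0e.
  apply: (@le_trans _ _ (entropy r rho f phi s)%:E).
    rewrite lee_fin.
    exact: (le_entropy r0 rho0 rho1 rhoC2 fsol dphiE ddphiE cddphi ddphi0 s0 st).
  apply: (int01_le_Lnorm1 (continuous_entropy_density s0 dphiE)
    (measurable_funB (mf s0) mf0) L0).
  - by move=> y _; rewrite mulr_ge0 ?phi0 ?u0// ltW.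
  - move=> y y01; rewrite /= !fE -mulrBr normrM gtr0_norm// mulrCA ler_pM2l//.
    by apply: phiL; [exact: u0|exact: u0b].
have /eqP := int01_eq0 cE (fun y _ => Epos y) E0 x01.
by rewrite mulf_eq0 gt_eqF//= => /eqP.
Qed.

Lemma relative_density_bounds (lo hi : R) : 0 < lo ->
  (forall x, 0 <= x <= 1 -> lo <= u 0 x <= hi) ->
  forall t x : R, 0 < t -> 0 <= x <= 1 -> lo <= u t x <= hi.
Proof.
move=> lo0 ub t x t0 x01.
have hi0 : 0 < hi.
  by have := ub x x01; lra.
apply/andP; split; rewrite leNgt; apply/negP => ux.
- have : below lo (u t x) = 0.
    apply: (@entropy_vanishes (below lo) (fun v => - 3 * pos_part (lo - v) ^+ 2)
      (fun v => 6 * pos_part (lo - v)) lo hi (lo ^+ 2)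
      (fun v _ => is_derive_below lo v) (fun v _ => is_derive2_below lo v)) => //.
    + move=> v _; apply: cvgM; first exact: cvg_cst.
      apply: (@continuous_comp _ _ _ (fun y => lo - y) (@pos_part R));
        last exact: continuous_pos_part.
      by apply: cvgB; [exact: cvg_cst|exact: cvg_id].
    + by move=> v _; rewrite mulr_ge0// pos_part_ge0.
    + by move=> v _; rewrite /below exprn_ge0// pos_part_ge0.
    + exact: sqr_ge0.
    + by move=> v w v0 /andP[low _]; apply: below_le => //; exact: ltW.
  apply/eqP; rewrite gt_eqF// /below pos_part_id; last by lra.
  by rewrite exprn_gt0// subr_gt0.
- have : above hi (u t x) = 0.
    apply: (@entropy_vanishes (above hi) _ _ lo hi 1 (is_derive_above hi)
      (is_derive2_above hi) (@continuous_derive2_above _ hi)) => //.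
    + move=> v v0; rewrite divr_ge0 ?exprn_ge0 ?(ltW v0)//.
      by rewrite mulr_ge0 ?sqr_ge0// mulr_ge0// pos_part_ge0.
    + by move=> v _; exact: above_ge0.
    + by move=> v w v0 /andP[_ whi]; rewrite mul1r; apply: above_le => //; exact: ltW.
  apply/eqP; rewrite gt_eqF// /above pos_part_id; last by lra.
  by rewrite divr_gt0 ?exprn_gt0// ?u0// subr_gt0.
Qed.

(** The linear functions id and - id are both convex, so the corresponding
    entropies, which are the mass and its opposite, are both nonincreasing; the
    constant value is identified in the limit t -> 0+. *)
Lemma mass_conserved t : 0 < t -> int01 (f t) = 1.
Proof.
move=> t0.
have idE (s : R) : int01 (f s) = entropy r rho f id s.
  by apply: eq_int01 => x _; rewrite fE.
have NidE s : 0 < s -> entropy r rho f (fun v => - 1 * v) s = - int01 (f s).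
  move=> s0; rewrite -[RHS]mulN1r -int01Z;
    last exact: (continuous_pos_slice (sol_continuous fsol) s0).
  by apply: eq_int01 => x _; rewrite fE mulrCA.
have d1 (v : R) (_ : 0 < v) : is_derive v 1 id (1 : R) := is_derive_id v 1.
have dN (v : R) (_ : 0 < v) : is_derive v 1 (fun v : R => - 1 * v) (- 1 * 1 : R) :=
  derZ (- 1) (is_derive_id v 1).
have d2 (c v : R) (_ : 0 < v) : is_derive v 1 (fun=> c) (0 : R) :=
  is_derive_cst c v 1.
have c0 (v : R) (_ : 0 < v) : {for v, continuous (fun=> 0 : R)} by exact: cvg_cst.
have const s : 0 < s -> s <= t -> int01 (f s) = int01 (f t).
  move=> s0 st; apply/eqP; rewrite eq_le; apply/andP; split; last first.
    rewrite !idE.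
    exact: (le_entropy r0 rho0 rho1 rhoC2 fsol d1 (@d2 1) c0 (fun _ _ => lexx
      0) s0 st).
  rewrite -lerN2 -!NidE//.
  exact: (le_entropy r0 rho0 rho1 rhoC2 fsol dN (@d2 (- 1 * 1)) c0
    (fun _ _ => lexx 0) s0 st).
have [_ f00 I0] := f0dens.
have fs0 s x : 0 < s -> 0 <= f s x by move=> /ltW s0; exact/ltW/(sol_gt0 fsol).
have IE s : 0 < s -> integral01 (f s) = (int01 (f s))%:E.
  move=> s0; apply: int01_integral_completed; last by move=> x _; exact: fs0.
  exact: (continuous_pos_slice (sol_continuous fsol) s0).
apply/eqP; rewrite eq_le; apply/andP; split.
- apply: (@le_of_cvg0_right _ (fun s => D s) _ _ 1 t (sol_init fsol) t0) => s s0 st.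
  rewrite -(const s)// -IE// mul1e -[X in (_ <= X + _)%E]I0.
  by apply: (Lnorm1_triangle (mf s0) mf0) => // x _; exact: fs0.
- apply: (@le_of_cvg0_right _ (fun s => D s) _ _ 1 t (sol_init fsol) t0) => s s0 st.
  rewrite -(const s)// -IE// mul1e -[leLHS]I0.
  have -> : D s = Lnorm01 1 (fun x => f 0 x - f s x).
    by rewrite !Lnorm01_1; apply: eq_integral => x _; rewrite distrC.
  by apply: (Lnorm1_triangle mf0 (mf s0)) => // x _; exact: fs0.
Qed.

End convergence.

(** * Convergence to equilibrium *)

Section decay.
Context {R : realType} {r alpha : R} {rho : R -> R} {f : R -> R -> R}.
Context (r0 : 0 < r).
Context (rho0 : forall x, 0 < rho x).
Context (rho1 : periodic rho 1).
Context (rhoC2 : C2_holder alpha rho).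
Context (fsol : solution r alpha rho f).
Context (f0dens : prob_density (f 0)).

Notation m := (equilibrium r rho).
Notation u := (relative_density r rho f).
Notation a := (mobility r rho f).
Notation gamma := (int01 m)^-1.
Notation E := (entropy r rho f (fun v => (v - gamma) ^+ 2)).

Context {nu K : R}.
Context (nu0 : 0 < nu).
Context (m_bounds : forall x, 0 <= x <= 1 -> nu <= m x <= nu^-1).
Context (u_le : forall t x : R, 0 < t -> 0 <= x <= 1 -> u t x <= K).

Let mE : continuous m := continuous_equilibrium rho0 rhoC2.
Let m0 x : 0 < m x := @equilibrium_gt0 _ r _ rho0 x.
Let u0 t x (t0 : 0 < t) : 0 < u t x :=
  @relative_density_gt0 _ _ _ _ _ rho0 fsol t x (ltW t0).
Let K0 : 0 < K.
Proof. by apply: (lt_le_trans (u0 0 ltr01)); apply: u_le; rewrite // lexx ler01. Qed.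

Lemma int01_equilibrium_bounds : nu <= int01 m <= nu^-1.
Proof.
apply/andP; split.
- rewrite -(int01_cst nu); apply: le_int01 => //; first by move=> ?; exact: cvg_cst.
  by move=> x /m_bounds/andP[].
- rewrite -(int01_cst nu^-1); apply: le_int01 => //; first by move=> ?;
  exact: cvg_cst.
  by move=> x /m_bounds/andP[].
Qed.

Let im0 : 0 < int01 m.
Proof. by case/andP: int01_equilibrium_bounds => h _; exact: lt_le_trans h. Qed.

Definition mobility_lower_bound : R := nu * K `^ (- (r + 1)).

Lemma mobility_lower_bound_gt0 : 0 < mobility_lower_bound.
Proof. by rewrite mulr_gt0// powR_gt0. Qed.

(** Along the solution the mobility is m * u ^ - (r + 1), with m >= nu and
    u <= K. *)
Lemma mobility_ge t x : 0 < t -> 0 <= x <= 1 -> mobility_lower_bound <= a t x.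
Proof.
move=> t0 x01; have ux := u0 x t0.
have -> : a t x = m x * u t x `^ (- (r + 1)).
  have -> : u t x `^ (- (r + 1)) = u t x * u t x `^ (- (r + 1) - 1).
    rewrite -[X in X * _](powRr1 (ltW ux)) -powRD;
      last by rewrite (gt_eqF ux) implybT.
    by congr (_ `^ _); ring.
  by rewrite mulrA [m x * _]mulrC [_ * m x]divfK// gt_eqF.
have /andP[num _] := m_bounds x01.
apply: ler_pM => //; first exact: ltW.
  exact: powR_ge0.
rewrite !powRN lef_pV2 ?posrE ?powR_gt0//.
apply: ge0_ler_powR; rewrite ?nnegrE; [|exact: ltW|exact: ltW|exact: u_le].
by rewrite addr_ge0// ltW.
Qed.

(** Poincare inequality for u - gamma, whose mean against m is the total mass
    minus gamma int m, that is 1 - 1. *)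
Lemma quadratic_entropy_le_energy t : 0 < t ->
  E t <= nu^-1 * int01 (fun x => derive1 (u t) x ^+ 2).
Proof.
move=> t0; have := is_derive_relative_density rho0 rhoC2 fsol.
move=> /(_ t _ t0) du.
have cdu := continuous_derive1_relative_density rho0 rhoC2 fsol t0.
have cu := continuous_relative_density rho0 rhoC2 fsol t0.
have dw (x : R) : is_derive x 1 (fun y => u t y - gamma) (derive1 (u t) x).
  by apply: (der_eq (derB (du x) (is_derive_cst gamma x 1))); rewrite subr0.
have cw : continuous (fun x => u t x - gamma) by move=> x;
  exact: der_continuous (dw x).
have cmu : continuous (fun x => m x * u t x).
  by move=> x; apply: cvgM; [exact: mE|exact: cu].
have mean0 : int01 (fun x => m x * (u t x - gamma)) = 0.
  have -> : int01 (fun x => m x * (u t x - gamma)) =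
      int01 (fun x => m x * u t x - gamma * m x).
    by apply: eq_int01 => x _; ring.
  rewrite int01B//; last by move=> x; apply: cvgM; [exact: cvg_cst|exact: mE].
  rewrite int01Z// mulVf ?gt_eqF//.
  rewrite [X in X - _](_ : _ = int01 (f t)).
    by rewrite (mass_conserved r0 rho0 rho1 rhoC2 fsol f0dens t0) subrr.
  by apply: eq_int01 => x _; rewrite /relative_density mulrC divfK// gt_eqF.
have P := sqr_le_energy mE (fun x _ => ltW (m0 x)) im0 dw cdu mean0.
set en := int01 (fun x => derive1 (u t) x ^+ 2) in P *.
have en0 : 0 <= en by apply: int01_ge0 => x _; exact: sqr_ge0.
apply: (@le_trans _ _ (int01 (fun x => en * m x))).
  apply: le_int01.
  - by move=> x; apply: cvgM; [exact: mE|apply: cvgM; exact: cw].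
  - by move=> x; apply: cvgM; [exact: cvg_cst|exact: mE].
  - by move=> x x01; rewrite mulrC ler_pM2r//; exact: P.
rewrite int01Z// mulrC ler_wpM2r//.
by case/andP: int01_equilibrium_bounds.
Qed.

(** The factor r (r + 1) comes from the dissipation identity, 2 from the second
    derivative of the quadratic entropy and nu from the Poincare inequality. *)
Definition decay_rate : R := 2 * (r * (r + 1)) * mobility_lower_bound * nu.

Lemma decay_rate_gt0 : 0 < decay_rate.
Proof.
have r10 : 0 < r + 1 by rewrite addr_gt0.
apply: mulr_gt0 => //; apply: mulr_gt0; first by rewrite !mulr_gt0.
exact: mobility_lower_bound_gt0.
Qed.

Lemma quadratic_entropy_decay (B : R) : 0 <= B ->
  (forall t, 0 < t -> E t <= B) ->
  forall t : R, 0 < t -> E t <= B * expR decay_rate * expR (- decay_rate * t).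
Proof.
move=> B0 EB.
have d1 (v : R) (_ : 0 < v) : is_derive v 1 (fun v => (v - gamma) ^+ 2)
  (2 * (v - gamma)).
  have h := derX 1 (derB (is_derive_id v 1) (is_derive_cst gamma v 1)).
  by apply: (der_eq h); rewrite subr0 mulr1 expr1.
have d2 (v : R) (_ : 0 < v) : is_derive v 1 (fun v => 2 * (v - gamma)) (2 : R).
  have h := derZ 2 (derB (is_derive_id v 1) (is_derive_cst gamma v 1)).
  by apply: (der_eq h); rewrite subr0 mulr1.
have c2 (v : R) (_ : 0 < v) : {for v, continuous (fun=> 2 : R)} by exact: cvg_cst.
apply: (exponential_decay (ltW decay_rate_gt0) B0
  (fun t t0 => is_derive_entropy r0 rho0 rho1 rhoC2 fsol d1 d2 c2 t0) _ EB) => t t0.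
have cdu := continuous_derive1_relative_density rho0 rhoC2 fsol t0.
have ca := continuous_mobility rho0 rhoC2 fsol t0.
rewrite mulNr mulNr lerN2.
apply: (@le_trans _ _ (r * (r + 1) * (2 * mobility_lower_bound * int01
  (fun x => derive1 (u t) x ^+ 2)))).
  have -> : r * (r + 1) * (2 * mobility_lower_bound * int01 (fun x => derive1
    (u t) x ^+ 2)) =
    decay_rate * (nu^-1 * int01 (fun x => derive1 (u t) x ^+ 2)).
    by rewrite /decay_rate; field; rewrite gt_eqF.
  by rewrite ler_pM2l ?decay_rate_gt0//; exact: quadratic_entropy_le_energy.
rewrite ler_wpM2l//; first by rewrite mulr_ge0// ?addr_ge0// ltW.
have cdu2 : continuous (fun x => derive1 (u t) x ^+ 2).
  by move=> x; apply: cvgM; exact: cdu.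
rewrite -int01Z//; apply: le_int01.
- by move=> x; apply: cvgM; [exact: cvg_cst|exact: cdu2].
- by move=> x; apply: cvgM; [exact: cvg_cst|apply: cvgM; [exact: ca|exact: cdu2]].
- move=> x x01; rewrite -mulrA ler_pM2l// ler_wpM2r ?sqr_ge0//.
  exact: mobility_ge.
Qed.

End decay.

Lemma periodic_itv01 (R : realType) (g : R -> R) (x : R) : periodic g 1 ->
  exists2 y, 0 <= y <= 1 & g x = g y.
Proof.
move=> g1; exists (x - (Num.floor x)%:~R).
  have /andP[xl xu] := floor_itv x.
  by rewrite intrD in xu; lra.
case: (Num.floor x) => n.
- by rewrite -[in LHS](subrK (n%:R) x) (periodicn g1).
- by rewrite NegzE mulrNz opprK (periodicn g1 n.+1).
Qed.

Lemma periodic_gt0 (R : realType) (g : R -> R) (b : R) : periodic g 1 -> 0 < b ->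
  (forall x, 0 <= x <= 1 -> b <= g x) -> forall x, 0 < g x.
Proof.
move=> g1 b0 bg x; have [y y01 ->] := periodic_itv01 x g1.
exact: lt_le_trans (bg y y01).
Qed.

Lemma equilibrium_bounds (R : realType) (r lambda : R) (rho : R -> R) (x : R) :
  0 < r + 1 -> 0 < lambda -> lambda <= rho x <= lambda^-1 ->
  lambda `^ (r + 1)^-1 <= equilibrium r rho x <= (lambda `^ (r + 1)^-1)^-1.
Proof.
move=> r10 l0 /andP[lr rl].
have p0 : 0 <= (r + 1)^-1 by rewrite invr_ge0 ltW.
have rho0 : 0 <= rho x by rewrite (le_trans _ lr)// ltW.
apply/andP; split; first by apply: ge0_ler_powR; rewrite ?nnegrE// ltW.
have -> : (lambda `^ (r + 1)^-1)^-1 = lambda^-1 `^ (r + 1)^-1.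
  by rewrite -powR_inv1 ?powR_ge0// -(powR_inv1 (ltW l0)) -!powRrM mulrC.
by apply: ge0_ler_powR; rewrite ?nnegrE// invr_ge0 ltW.
Qed.

Theorem theorem1p1 (R : realType) (r lambda a1 A1 : R)
    (hr : 1 < r) (hlambda : 0 < lambda <= 1) (ha1 : 0 < a1) :
  exists C0 c0 : R, [/\ 0 < C0, 0 < c0 &
    forall (alpha : R) (rho : R -> R) (f : R -> R -> R),
      0 < alpha < 1 ->
      periodic rho 1 ->
      (forall x : R, 0 <= x <= 1 -> lambda <= rho x <= lambda^-1) ->
      prob_density rho ->
      C2_holder alpha rho ->
      prob_density (f 0) ->
      (forall x : R, 0 <= x <= 1 -> a1 <= f 0 x <= A1) ->
      solution r alpha rho f ->
      (forall t x : R, 0 <= t -> 0 <= x <= 1 ->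
         a1 * lambda `^ (2 / (r + 1)) <= f t x
           <= A1 / lambda `^ (2 / (r + 1))) /\
      (forall t : R, 0 <= t ->
         (Lnorm01 2%:E
            (fun x => f t x - gamma_cst r rho * rho x `^ (r + 1)^-1)%R
          <= (C0 * expR (- c0 * t))%:E)%E)].
Proof.
(* if A1 < a1 no datum satisfies the bounds and the constants are arbitrary *)
have [aA|Aa] := leP a1 A1; last first.
  exists 1, 1; split => // alpha rho f _ _ _ _ _ _ f0b _.
  have /f0b/andP[h1 h2] : 0 <= (0 : R) <= 1 by rewrite lexx ler01.
  by have := lt_le_trans Aa (le_trans h1 h2); rewrite ltxx.
have /andP[l0 l1] := hlambda.
have A0 : 0 < A1 by exact: lt_le_trans aA.
have r0 : 0 < r by lra.
have r10 : 0 < r + 1 by lra.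
pose nu := lambda `^ (r + 1)^-1.
have nu0 : 0 < nu by rewrite powR_gt0.
have nu1 : nu <= 1.
  have one : (1 : R) `^ (r + 1)^-1 = 1 by rewrite powR1.
  rewrite /nu -[leRHS]one; apply: ge0_ler_powR; rewrite ?nnegrE//.
  - by rewrite invr_ge0 ltW.
  - exact: ltW.
have nu2E : lambda `^ (2 / (r + 1)) = nu ^+ 2.
  by rewrite mulrC powRrM powR_mulrn// ltW.
rewrite nu2E.
pose K := A1 / nu.
have K0 : 0 < K by rewrite divr_gt0.
pose c := decay_rate (r := r) (nu := nu) (K := K).
have c_gt0 : 0 < c.
  by rewrite /c /decay_rate /mobility_lower_bound !mulr_gt0// powR_gt0.
pose B1 := (A1 / nu ^+ 2) ^+ 2 + (nu ^- 2) ^+ 2.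
have B10 : 0 <= B1 by rewrite addr_ge0// sqr_ge0.
pose Q := B1 / nu ^+ 2 * expR c.
have Q0 : 0 <= Q by rewrite mulr_ge0 ?expR_ge0// divr_ge0// sqr_ge0.
(* the L^2 norm is a square root, which halves the rate; Q <= (Q + 1) ^ 2
   spares a square root in the constant *)
exists (Q + 1), (c / 2); split; [by lra|by lra|].
move=> alpha rho f _ rho1 rhob _ rhoC2 f0dens f0b fsol.
have rho0 : forall x, 0 < rho x.
  by apply: (periodic_gt0 rho1 l0) => x /rhob/andP[].
pose m := equilibrium r rho.
have m0 x : 0 < m x by exact: equilibrium_gt0.
have mb x : 0 <= x <= 1 -> nu <= m x <= nu^-1.
  by move=> x01; apply: equilibrium_bounds => //; exact: rhob.
have fE t x : f t x = m x * relative_density r rho f t x.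
  by rewrite /relative_density mulrC divfK// gt_eqF// m0.
have ub0 x : 0 <= x <= 1 -> a1 * nu <= relative_density r rho f 0 x <= K.
  move=> x01; have /andP[f1 f2] := f0b x x01; have /andP[m1 m2] := mb x x01.
  rewrite /relative_density -/(m x); apply/andP; split.
  - by rewrite ler_pdivlMr//; apply: (le_trans _ f1);
    rewrite -mulrA ler_piMr ?(ltW ha1)// -(mulfV (lt0r_neq0 nu0)) ler_pM2l.
  - rewrite ler_pdivrMr// /K; apply: (le_trans f2).
    by rewrite -mulrA ler_peMr ?(ltW A0)// mulrC ler_pdivlMr// mul1r.
have ub t x : 0 < t -> 0 <= x <= 1 -> a1 * nu <= relative_density r rho f t x <= K.
  exact: (relative_density_bounds r0 rho0 rho1 rhoC2 fsol f0dens
    (mulr_gt0 ha1 nu0) ub0).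
have fb t x : 0 <= t -> 0 <= x <= 1 -> a1 * nu ^+ 2 <= f t x <= A1 / nu ^+ 2.
  move=> t0 x01; have /andP[m1 m2] := mb x x01.
  have /andP[u1 u2] : a1 * nu <= relative_density r rho f t x <= K.
    by move: t0; rewrite le_eqVlt => /predU1P[<-|t0]; [exact: ub0|exact: ub].
  rewrite fE; apply/andP; split.
  - rewrite expr2 mulrA [leLHS]mulrC; apply: ler_pM => //; first exact: ltW.
    by rewrite mulr_ge0// ltW.
  - have -> : A1 / nu ^+ 2 = nu^-1 * K by rewrite /K; field; rewrite gt_eqF.
    apply: ler_pM => //; first exact: ltW (m0 x).
    by apply: (le_trans _ u1); rewrite mulr_ge0// ltW.
split=> // t t0.
have cm : continuous m := continuous_equilibrium rho0 rhoC2.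
have gE : gamma_cst r rho = (int01 m)^-1.
  rewrite /gamma_cst /integral01 (int01_integral_completed cm)// => x _.
  exact/ltW/m0.
pose g := (int01 m)^-1.
have /andP[im1 im2] : nu <= int01 m <= nu^-1 := int01_equilibrium_bounds rho0
  rhoC2 mb.
have im0 : 0 < int01 m by exact: lt_le_trans im1.
have g0 : 0 < g by rewrite invr_gt0.
have gnu : g <= nu^-1 by rewrite lef_pV2.
(* valid at time 0 too: it bounds the datum's own deviation as well as the
   entropy at small times, from which the decay starts *)
have devB s x : 0 <= s -> 0 <= x <= 1 -> (f s x - g * m x) ^+ 2 <= B1.
  move=> s0 x01; have /andP[f1 f2] := fb s x s0 x01; have /andP[m1 m2] := mb x x01.
  have fp : 0 < f s x by exact: (sol_gt0 fsol).
  have gm0 : 0 < g * m x by rewrite mulr_gt0.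
  have gm : g * m x <= nu ^- 2.
    by rewrite expr2 invfM; apply: ler_pM => //; exact: ltW.
  have h1 : f s x ^+ 2 <= (A1 / nu ^+ 2) ^+ 2.
    by rewrite ler_sqr ?nnegrE// ?(ltW fp)// (le_trans _ f2)// ltW.
  have h2 : (g * m x) ^+ 2 <= (nu ^- 2) ^+ 2.
    by rewrite ler_sqr ?nnegrE// ?(ltW gm0)// (le_trans _ gm)// ltW.
  rewrite /B1; nra.
rewrite gE -/g; apply: Lnorm01_2_le.
  by rewrite mulr_ge0 ?expR_ge0//; lra.
have e2 : ((Q + 1) * expR (- (c / 2) * t)) ^+ 2 = (Q + 1) ^+ 2 * expR (- c * t).
  by rewrite exprMn -expRM_natl; congr (_ * expR _); field.
rewrite e2.
have QQ : Q <= (Q + 1) ^+ 2 by nra.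
(* at t = 0 the equation gives nothing: the pointwise bound is integrated, the
   datum being only Lebesgue measurable *)
move: (t0); rewrite le_eqVlt => /predU1P[<-|tp].
  rewrite mulr0 expR0 mulr1.
  have [mf0 _ _] := f0dens.
  have cgm : continuous (fun x => g * m x) by move=> x; apply: cvgM;
    [exact: cvg_cst|exact: cm].
  have mdev := measurable_funB mf0 (measurable_lebesgue cgm).
  apply: (@le_trans _ _ (\int[@completed_lebesgue_measure R]_(x in @unit_itv R)
    B1%:E)%E).
    apply: ge0_le_integral.
    - exact: measurable_unit_itv.
    - by move=> x _; rewrite lee_fin sqr_ge0.
    - apply/measurable_EFinP; exact: (measurable_funX 2 mdev).
    - exact: measurable_cst.
    - by move=> x x01; rewrite lee_fin; apply: devB.
  have cB1 : continuous (fun _ : R => B1) by move=> ?; exact: cvg_cst.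
  rewrite (int01_integral_completed cB1); last by [].
  rewrite int01_cst lee_fin (le_trans _ QQ)// /Q -mulrA ler_peMr//.
  rewrite mulrC ler_pdivlMr ?exprn_gt0// mul1r.
  apply: (@le_trans _ _ 1); first by rewrite expr_le1// ltW.
  by rewrite -expR0 ler_expR ltW.
pose E := entropy r rho f (fun v => (v - g) ^+ 2).
have cu s : 0 < s -> continuous (relative_density r rho f s).
  by move=> s0; exact: (continuous_relative_density rho0 rhoC2 fsol s0).
have EmE s x : m x * (relative_density r rho f s x - g) ^+ 2 = (f s x - g * m
  x) ^+ 2 / m x.
  by rewrite fE; field; rewrite gt_eqF// m0.
have cE s : 0 < s ->
    continuous (fun x => m x * (relative_density r rho f s x - g) ^+ 2).
  move=> s0 x; apply: cvgM; first exact: cm.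
  by apply: cvgM; apply: cvgB; [exact: cu|exact: cvg_cst|exact: cu|exact: cvg_cst].
have EB s : 0 < s -> E s <= B1 / nu.
  move=> s0; rewrite -(int01_cst (B1 / nu)); apply: le_int01.
  - exact: cE.
  - by move=> ?; exact: cvg_cst.
  - move=> x x01; rewrite EmE; have /andP[m1 m2] := mb x x01.
    apply: ler_pM; [exact: sqr_ge0|by rewrite invr_ge0 ltW// m0|exact/devB/x01/ltW|].
    by rewrite lef_pV2// posrE m0.
have u_le s x : 0 < s -> 0 <= x <= 1 -> relative_density r rho f s x <= K.
  by move=> s0 x01; have /andP[] := ub s x s0 x01.
have Et := quadratic_entropy_decay r0 rho0 rho1 rhoC2 fsol f0dens nu0 mb u_le
  (divr_ge0 B10 (ltW nu0)) EB tp.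
have cdev : continuous (fun x => f t x - g * m x).
  move=> x; apply: cvgB; first exact: (continuous_pos_slice (sol_continuous fsol) tp).
  by apply: cvgM; [exact: cvg_cst|exact: cm].
have cdev2 : continuous (fun x => (f t x - g * m x) ^+ 2).
  by move=> x; apply: cvgM; exact: cdev.
rewrite (int01_integral_completed cdev2); last by move=> x _; exact: sqr_ge0.
rewrite lee_fin; apply: (@le_trans _ _ (nu^-1 * E t)).
  rewrite -int01Z; last exact: cE.
  apply: le_int01 => //.
    by move=> x; apply: cvgM; [exact: cvg_cst|exact: cE].
  move=> x x01; have /andP[m1 m2] := mb x x01.
  rewrite EmE mulrCA ler_peMr ?sqr_ge0//.
  by rewrite ler_pdivlMr ?m0// mul1r.
apply: (@le_trans _ _ (Q * expR (- c * t))); last by rewrite ler_wpM2r// expR_ge0.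
rewrite ler_pdivrMl//.
apply: (le_trans Et); rewrite le_eqVlt; apply/orP; left; apply/eqP.
rewrite /Q /c; field; rewrite gt_eqF//.
Qed.
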